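(* Let $A,B$ be models. (1) If $A$ and $B$ are isomorphic, then they are strongly equivalent. (2) If $A$ and $B$ are both complete and strongly equivalent, then they are isomorphic.
   Context: A model of computation over a set $X$ is any set of functions $f:X\to X\cup\{\bot\}$, where $\bot$ denotes ''undefined''. Injections are extended by $\rho(\bot)=\bot$. $A\succsim_\rho B$ means: for every $g\in B$ there is $f\in A$ with $\rho\circ g=f\circ\rho$; $A\succsim B$ means $A\succsim_\rho B$ for some injection $\rho$. $A$ and $B$ are strongly equivalent if there are bijections $\pi,\tau$ with $A\succsim_\pi B$ and $B\succsim_\tau A$. They are isomorphic if there is a bijection $\pi:\mathrm{dom}\,B\to\mathrm{dom}\,A$ with $A\succsim_\pi B$ and $B\succsim_{\pi^{-1}}A$. A model $A$ is complete if for every model $M$ over $\mathrm{dom}\,A$ with $M\supseteq A$ and $A\succsim M$, we have $M=A$. *)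

(* Defs.v *)
From mathcomp Require Import all_boot.
From mathcomp Require Import boolp classical_sets.

Set Implicit Arguments.
Unset Strict Implicit.
Unset Printing Implicit Defensive.

Local Open Scope classical_set_scope.

(* A value of [option X] is an element of X together with the undefined value
   [None]. *)
Definition model (X : Type) : Type := set (X -> option X).

(* A simulates B via rho : dom B -> dom A; [omap rho] is the extension of rho
   that maps undefined to undefined. *)
Definition simulates_via (X Y : Type) (rho : Y -> X) (A : model X)
    (B : model Y) : Prop :=
  forall g, B g -> exists2 f, A f & omap rho \o g = f \o rho.

Definition simulates (X Y : Type) (A : model X) (B : model Y) : Prop :=
  exists2 rho : Y -> X, injective rho & simulates_via rho A B.

Definition strongly_equivalent (X Y : Type) (A : model X) (B : model Y) : Prop :=
  (exists2 pi : Y -> X, bijective pi & simulates_via pi A B) /\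
  (exists2 tau : X -> Y, bijective tau & simulates_via tau B A).

(* The two cancellation laws say that pi is a bijection with inverse pi'. *)
Definition isomorphic (X Y : Type) (A : model X) (B : model Y) : Prop :=
  exists (pi : Y -> X) (pi' : X -> Y),
    [/\ cancel pi pi', cancel pi' pi,
        simulates_via pi A B & simulates_via pi' B A].

Definition complete (X : Type) (A : model X) : Prop :=
  forall M : model X, A `<=` M -> simulates A M -> M = A.

(* Main.v *)
(* If A simulates B via pi and B simulates A via tau, both bijective, then the
   transport M of B along tau^-1 contains A, and A simulates M via pi o tau.
   Completeness of A gives M = A, so tau^-1 is an isomorphism. *)

From mathcomp Require Import all_boot.
From mathcomp Require Import boolp classical_sets.
Require Import Defs.

Set Implicit Arguments.
Unset Strict Implicit.
Unset Printing Implicit Defensive.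

Lemma isomorphic_strongly_equivalent (X Y : Type) (A : model X) (B : model Y) :
  isomorphic A B -> strongly_equivalent A B.
Proof.
case=> pi [pi' [piK pi'K simAB simBA]].
by split; [exists pi | exists pi'] => //; [exists pi' | exists pi].
Qed.

(** Pullback of [B] under conjugation by [s], with [s'] in the role of its inverse. As a preimage,
    it makes membership of [f] a direct condition on [B]. *)
Definition transport (X Y : Type) (s : X -> Y) (s' : Y -> X) (B : model Y) :
    model X :=
  fun f => B (omap s \o f \o s').

Section Transport.
Variables (X Y : Type) (s : X -> Y) (s' : Y -> X).
Hypotheses (sK : cancel s s') (s'K : cancel s' s).

(** If [g] simulates [f] via [s], then cancelling [s \o s'] shows that the conjugate of [f] is [g]
    itself. *)
Lemma sub_transport (A : model X) (B : model Y) :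
  simulates_via s B A -> (A `<=` transport s s' B)%classic.
Proof.
move=> simBA f /simBA[g Bg sf]; rewrite /transport sf.
by have -> : (g \o s) \o s' = g by apply/funext => y /=; rewrite s'K.
Qed.

Lemma simulates_via_transport (B : model Y) :
  simulates_via s B (transport s s' B).
Proof.
move=> f Mf; exists (omap s \o f \o s') => //.
by apply/funext => x /=; rewrite sK.
Qed.

Lemma transport_simulates_via (B : model Y) :
  simulates_via s' (transport s s' B) B.
Proof.
(* The witness is the inverse conjugate of [g]; conjugating it back yields [g], hence it lies in the
   transport. *)
move=> g Bg; exists (omap s' \o g \o s); last first.
  by apply/funext => y /=; rewrite s'K.
rewrite /transport; have -> // : omap s \o (omap s' \o g \o s) \o s' = g.
by apply/funext => y /=; rewrite s'K; case: (g y) => //= z; rewrite s'K.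
Qed.

End Transport.

Lemma simulates_via_comp (X Y Z : Type) (r : Y -> X) (s : Z -> Y)
    (A : model X) (B : model Y) (C : model Z) :
  simulates_via r A B -> simulates_via s B C -> simulates_via (r \o s) A C.
Proof.
move=> simAB simBC h /simBC[g /simAB[f Af rg] sh]; exists f => //.
apply/funext => z; have /= <- := congr1 (@^~ (s z)) rg.
(* Splitting on whether [h z] is defined makes [omap (r \o s)] and [omap r \o omap s] agree by
   computation. *)
by have /= <- := congr1 (@^~ z) sh; case: (h z).
Qed.

Lemma complete_strongly_equivalent_isomorphic (X Y : Type) (A : model X)
    (B : model Y) :
  complete A -> strongly_equivalent A B -> isomorphic A B.
Proof.
move=> cA [[pi pi_bij simAB] [tau [tau' tauK tau'K] simBA]].
have MA : transport tau tau' B = A.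
  apply: cA; first exact: sub_transport.
  exists (pi \o tau).
    exact: inj_comp (bij_inj pi_bij) (can_inj tauK).
  by apply: (simulates_via_comp simAB); apply: simulates_via_transport.
(* The isomorphism comes from [tau] rather than [pi]: once [A] is seen as the transport of [B], it
   simulates [B] via [tau']. *)
exists tau', tau; split=> //.
by rewrite -MA; apply: transport_simulates_via.
Qed.

Theorem mainTheorem15 (X Y : Type) (A : model X) (B : model Y) :
  (isomorphic A B -> strongly_equivalent A B) /\
  (complete A -> complete B -> strongly_equivalent A B -> isomorphic A B).
Proof.
split; first exact: isomorphic_strongly_equivalent.
by move=> cA _; apply: complete_strongly_equivalent_isomorphic.
Qed.
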